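(* Let $K$ be an infinite field and let $L_\infty$ be the $K$-algebra with basis $\{e_1,e_2,\dots\}$ and multiplication $e_ie_1=e_{i+1}$ for all $i\ge1$, all other products of basis elements being zero. Then the single polynomial $x_1(x_2x_3)$ is a basis of $\mathrm{Id}(L_\infty)$.
   Context: A Leibniz algebra over $K$ is a (not necessarily associative) $K$-algebra satisfying $x(yz)=(xy)z-(xz)y$ for all $x,y,z$; $L_\infty$ is a Leibniz algebra. Let $\mathcal D(X)$ be the free Leibniz $K$-algebra on $X=\{x_1,x_2,\dots\}$ (non-unital). $\mathrm{Id}(L)$ is the set of $f\in\mathcal D(X)$ vanishing under every homomorphism $\mathcal D(X)\to L$. A T-ideal of $\mathcal D(X)$ is a (two-sided) ideal invariant under all endomorphisms of $\mathcal D(X)$. A subset $S\subseteq\mathrm{Id}(L)$ is a basis of $\mathrm{Id}(L)$ if $\mathrm{Id}(L)$ is the smallest T-ideal of $\mathcal D(X)$ containing $S$. *)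

(* Defs.v *)
From HB Require Import structures.
From mathcomp Require Import all_boot all_order all_algebra generic_quotient.
From mathcomp Require Import mathcomp_extra boolp classical_sets functions.
From mathcomp Require Import cardinality.

Set Implicit Arguments.
Unset Strict Implicit.
Unset Printing Implicit Defensive.

Import GRing.Theory.
Local Open Scope classical_set_scope.
Local Open Scope ring_scope.
Local Open Scope quotient_scope.

Reserved Notation "x ** y" (at level 40, left associativity).

(* A not necessarily associative, not necessarily unital K-algebra. *)
HB.mixin Record Lmodule_isNAlgebra (K : fieldType) A of GRing.Lmodule K A := {
  amul : A -> A -> A;
  amul_linearl : forall y : A, linear (amul^~ y);
  amul_linearr : forall x : A, linear (amul x)
}.

#[short(type="nalgType")]
HB.structure Definition NAlgebra (K : fieldType) :=
  {A of GRing.Lmodule K A & Lmodule_isNAlgebra K A}.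

Notation "x ** y" := (amul x y) : ring_scope.

HB.mixin Record NAlgebra_isLeibniz (K : fieldType) A of NAlgebra K A := {
  leibniz : forall x y z : A, x ** (y ** z) = (x ** y) ** z - (x ** z) ** y
}.

#[short(type="leibnizAlgType")]
HB.structure Definition LeibnizAlgebra (K : fieldType) :=
  {A of NAlgebra K A & NAlgebra_isLeibniz K A}.

Definition nalg_hom (K : fieldType) (A B : nalgType K) (f : A -> B) : Prop :=
  linear f /\ forall x y, f (x ** y) = f x ** f y.

(* The free Leibniz algebra on X is the algebra of formal expressions in X      *)
(* modulo the smallest congruence that makes the quotient a Leibniz K-algebra.  *)
(* It is non-unital; its universal property is [flift_hom], [flift_gen] and     *)
(* [flift_unique] below.                                                        *)
Section FreeLeibniz.
Variables (K : fieldType) (X : Type).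

Inductive lterm : Type :=
| LVar of X
| LZero
| LAdd of lterm & lterm
| LOpp of lterm
| LScale of K & lterm
| LMul of lterm & lterm.

Inductive lcong : lterm -> lterm -> Prop :=
| lcong_refl t : lcong t t
| lcong_sym t u : lcong t u -> lcong u t
| lcong_trans u t v : lcong t u -> lcong u v -> lcong t v
| lcong_add t t' u u' :
    lcong t t' -> lcong u u' -> lcong (LAdd t u) (LAdd t' u')
| lcong_opp t t' : lcong t t' -> lcong (LOpp t) (LOpp t')
| lcong_scale a t t' : lcong t t' -> lcong (LScale a t) (LScale a t')
| lcong_mul t t' u u' :
    lcong t t' -> lcong u u' -> lcong (LMul t u) (LMul t' u')
| lcong_addA t u v : lcong (LAdd t (LAdd u v)) (LAdd (LAdd t u) v)
| lcong_addC t u : lcong (LAdd t u) (LAdd u t)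
| lcong_add0 t : lcong (LAdd LZero t) t
| lcong_addN t : lcong (LAdd (LOpp t) t) LZero
| lcong_scaleA a b t : lcong (LScale a (LScale b t)) (LScale (a * b) t)
| lcong_scale1 t : lcong (LScale 1 t) t
| lcong_scaleDr a t u :
    lcong (LScale a (LAdd t u)) (LAdd (LScale a t) (LScale a u))
| lcong_scaleDl t a b :
    lcong (LScale (a + b) t) (LAdd (LScale a t) (LScale b t))
| lcong_mull a t u v : lcong (LMul (LAdd (LScale a t) u) v)
                             (LAdd (LScale a (LMul t v)) (LMul u v))
| lcong_mulr a t u v : lcong (LMul v (LAdd (LScale a t) u))
                             (LAdd (LScale a (LMul v t)) (LMul v u))
| lcong_leibniz t u v : lcong (LMul t (LMul u v))
                        (LAdd (LMul (LMul t u) v) (LOpp (LMul (LMul t v) u))).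

HB.instance Definition _ := gen_eqMixin lterm.
HB.instance Definition _ := gen_choiceMixin lterm.

Definition lcongb (t u : lterm) : bool := `[< lcong t u >].

Lemma lcongb_refl : reflexive lcongb.
Proof. by move=> t; apply/asboolP/lcong_refl. Qed.

Lemma lcongb_sym : symmetric lcongb.
Proof. by move=> t u; apply/asboolP/asboolP => /lcong_sym. Qed.

Lemma lcongb_trans : transitive lcongb.
Proof.
by move=> u t v /asboolP tu /asboolP uv; apply/asboolP/(lcong_trans tu uv).
Qed.

Canonical lcongb_equiv :=
  EquivRel lcongb lcongb_refl lcongb_sym lcongb_trans.

Definition freeLeibniz : Type := {eq_quot lcongb}.

HB.instance Definition _ := Choice.on freeLeibniz.

Definition fclass (t : lterm) : freeLeibniz := \pi_({eq_quot lcongb}) t.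
Definition frepr (x : freeLeibniz) : lterm := repr (x : {eq_quot lcongb}).

Lemma freprK x : fclass (frepr x) = x.
Proof. exact: reprK. Qed.

Lemma fclassP t u : fclass t = fclass u <-> lcong t u.
Proof. by split=> [/eqmodP/asboolP|tu] //; apply/eqmodP/asboolP. Qed.

Lemma frepr_class t : lcong (frepr (fclass t)) t.
Proof. by apply/fclassP; rewrite freprK. Qed.

Definition fzero := fclass LZero.
Definition fadd x y := fclass (LAdd (frepr x) (frepr y)).
Definition fopp x := fclass (LOpp (frepr x)).
Definition fscale a x := fclass (LScale a (frepr x)).
Definition fmul x y := fclass (LMul (frepr x) (frepr y)).

Lemma faddE t u : fadd (fclass t) (fclass u) = fclass (LAdd t u).
Proof. by apply/fclassP/lcong_add; apply: frepr_class. Qed.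

Lemma foppE t : fopp (fclass t) = fclass (LOpp t).
Proof. by apply/fclassP/lcong_opp/frepr_class. Qed.

Lemma fscaleE a t : fscale a (fclass t) = fclass (LScale a t).
Proof. by apply/fclassP/lcong_scale/frepr_class. Qed.

Lemma fmulE t u : fmul (fclass t) (fclass u) = fclass (LMul t u).
Proof. by apply/fclassP/lcong_mul; apply: frepr_class. Qed.

Lemma faddA : associative fadd.
Proof.
move=> x y z; rewrite -[x]freprK -[y]freprK -[z]freprK !faddE.
exact/fclassP/lcong_addA.
Qed.

Lemma faddC : commutative fadd.
Proof.
by move=> x y; rewrite -[x]freprK -[y]freprK !faddE; apply/fclassP/lcong_addC.
Qed.

Lemma fadd0 : left_id fzero fadd.
Proof. by move=> x; rewrite -[x]freprK faddE; apply/fclassP/lcong_add0. Qed.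

Lemma faddN : left_inverse fzero fopp fadd.
Proof.
by move=> x; rewrite -[x]freprK foppE faddE; apply/fclassP/lcong_addN.
Qed.

HB.instance Definition _ :=
  GRing.isZmodule.Build freeLeibniz faddA faddC fadd0 faddN.

Lemma fscaleA a b x : fscale a (fscale b x) = fscale (a * b) x.
Proof. by rewrite -[x]freprK !fscaleE; apply/fclassP/lcong_scaleA. Qed.

Lemma fscale1 : left_id 1 fscale.
Proof. by move=> x; rewrite -[x]freprK fscaleE; apply/fclassP/lcong_scale1. Qed.

Lemma fscaleDr : right_distributive fscale +%R.
Proof.
move=> a x y; rewrite -[x]freprK -[y]freprK /GRing.add /= !(faddE, fscaleE).
exact/fclassP/lcong_scaleDr.
Qed.

Lemma fscaleDl x : {morph fscale^~ x : a b / a + b}.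
Proof.
move=> a b; rewrite -[x]freprK !fscaleE [RHS]faddE.
exact/fclassP/lcong_scaleDl.
Qed.

HB.instance Definition _ := GRing.Zmodule_isLmodule.Build K freeLeibniz
  fscaleA fscale1 fscaleDr fscaleDl.

Lemma fmul_linearl (y : freeLeibniz) : linear (fmul^~ y).
Proof.
move=> a x z; rewrite -[x]freprK -[y]freprK -[z]freprK.
rewrite /GRing.add /GRing.scale /= !(fscaleE, fmulE, faddE).
exact/fclassP/lcong_mull.
Qed.

Lemma fmul_linearr (x : freeLeibniz) : linear (fmul x).
Proof.
move=> a y z; rewrite -[x]freprK -[y]freprK -[z]freprK.
rewrite /GRing.add /GRing.scale /= !(fscaleE, fmulE, faddE).
exact/fclassP/lcong_mulr.
Qed.

HB.instance Definition _ :=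
  Lmodule_isNAlgebra.Build K freeLeibniz fmul_linearl fmul_linearr.

Lemma fmul_leibniz (x y z : freeLeibniz) :
  x ** (y ** z) = (x ** y) ** z - (x ** z) ** y.
Proof.
rewrite -[x]freprK -[y]freprK -[z]freprK /amul /=.
rewrite /GRing.add /GRing.opp /= !(fmulE, foppE, faddE).
exact/fclassP/lcong_leibniz.
Qed.

HB.instance Definition _ :=
  NAlgebra_isLeibniz.Build K freeLeibniz fmul_leibniz.

Definition fgen (i : X) : freeLeibniz := fclass (LVar i).

Section Lift.
Variables (L : leibnizAlgType K) (phi : X -> L).

Fixpoint leval (t : lterm) : L :=
  match t with
  | LVar i => phi i
  | LZero => 0
  | LAdd t u => leval t + leval u
  | LOpp t => - leval t
  | LScale a t => a *: leval t
  | LMul t u => leval t ** leval u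
  end.

Lemma leval_cong t u : lcong t u -> leval t = leval u.
Proof.
elim=> //=.
- by move=> ? ? ? _ -> _ ->.
- by move=> ? ? ? ? _ -> _ ->.
- by move=> ? ? _ ->.
- by move=> ? ? ? _ ->.
- by move=> ? ? ? ? _ -> _ ->.
- by move=> ? ? ?; rewrite addrA.
- by move=> ? ?; rewrite addrC.
- by move=> ?; rewrite add0r.
- by move=> ?; rewrite addNr.
- by move=> ? ? ?; rewrite scalerA.
- by move=> ?; rewrite scale1r.
- by move=> ? ? ?; rewrite scalerDr.
- by move=> ? ? ?; rewrite scalerDl.
- by move=> ? ? ? ?; rewrite amul_linearl.
- by move=> ? ? ? ?; rewrite amul_linearr.
- by move=> ? ? ?; rewrite leibniz.
Qed.

Definition flift (x : freeLeibniz) : L := leval (frepr x).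

Lemma fliftE t : flift (fclass t) = leval t.
Proof. exact/leval_cong/frepr_class. Qed.

Lemma flift_gen i : flift (fgen i) = phi i.
Proof. exact: fliftE. Qed.

Lemma flift_hom : nalg_hom flift.
Proof.
split=> [a x y|x y]; rewrite -[x]freprK -[y]freprK.
  by rewrite /GRing.add /GRing.scale /= fscaleE faddE !fliftE.
by rewrite {1}/amul /= fmulE !fliftE.
Qed.

Lemma flift_unique (f : freeLeibniz -> L) :
  nalg_hom f -> (forall i, f (fgen i) = phi i) -> f =1 flift.
Proof.
move=> [flin fM] fX x; rewrite -[x]freprK fliftE.
have fZD := flin.
have f0 : f 0 = 0.
  by have := fZD (-1) 0 0; rewrite scaleN1r addNr scaleN1r addNr.
have fD u v : f (u + v) = f u + f v by have := fZD 1 u v; rewrite !scale1r.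
have fZ a u : f (a *: u) = a *: f u by have := fZD a u 0; rewrite f0 !addr0.
have fN u : f (- u) = - f u by rewrite -scaleN1r fZ scaleN1r.
elim: (frepr x) => //= [t <- u <-|t <-|a t <-|t <- u <-].
- by rewrite -fD -[RHS]/(f (fadd _ _)) faddE.
- by rewrite -fN -[RHS]/(f (fopp _)) foppE.
- by rewrite -fZ -[RHS]/(f (fscale _ _)) fscaleE.
- by rewrite -fM -[RHS]/(f (fmul _ _)) fmulE.
Qed.

End Lift.
End FreeLeibniz.

(* The alphabet {x_1, x_2, ...} is nat: the generator ['x_i] is x_(i+1).         *)
Notation "''x_' i" := (fgen _ i%N) (at level 8, i at level 2) : ring_scope.

Section Identities.
Variable K : fieldType.

Definition Id (L : leibnizAlgType K) : set (freeLeibniz K nat) :=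
  [set f | forall h : freeLeibniz K nat -> L, nalg_hom h -> h f = 0].

Definition ideal (A : nalgType K) (I : set A) : Prop :=
  [/\ I 0,
      forall (a : K) (u v : A), I u -> I v -> I (a *: u + v),
      forall u v : A, I u -> I (u ** v)
    & forall u v : A, I v -> I (u ** v)].

Definition T_ideal (I : set (freeLeibniz K nat)) : Prop :=
  ideal I /\
  forall h : freeLeibniz K nat -> freeLeibniz K nat,
    nalg_hom h -> forall u, I u -> I (h u).

(* [smallest T_ideal S] is the intersection of all the T-ideals that contain S; *)
(* it is itself a T-ideal, by [smallest_T_ideal].                               *)
Definition Id_basis (L : leibnizAlgType K) (S : set (freeLeibniz K nat)) :=
  S `<=` Id L /\ Id L = smallest T_ideal S.

Lemma smallest_T_ideal S : T_ideal (smallest T_ideal S).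
Proof.
split; first split.
- by move=> I [[[]]].
- move=> a u v Su Sv I SI; have [[[_ IZD _ _] _] _] := SI.
  exact: IZD (Su _ SI) (Sv _ SI).
- move=> u v Su I SI; have [[[_ _ IM _] _] _] := SI; exact: IM (Su _ SI).
- move=> u v Sv I SI; have [[[_ _ _ IM] _] _] := SI; exact: IM (Sv _ SI).
- move=> h hh u Su I SI; have [[_ Ih] _] := SI; exact: Ih (Su _ SI).
Qed.

End Identities.

(* L_oo: the underlying vector space is {poly K}, used only as a space with a   *)
(* countable basis; e_(i+1) is 'X^i, written [linf_e i]. The ring product of    *)
(* {poly K} is not the product of the algebra.                                  *)
Section Linf.
Variable K : fieldType.

Definition Linf : Type := {poly K}.

HB.instance Definition _ := GRing.Lmodule.on Linf.

Definition linf_e (i : nat) : Linf := ('X^i : {poly K}).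

(* e_(i+1) e_(j+1) *)
Definition linf_table (i j : nat) : Linf :=
  if j == 0%N then linf_e i.+1 else 0.

Definition linf_mul (f g : Linf) : Linf :=
  \sum_(i < size (f : {poly K})) \sum_(j < size (g : {poly K}))
    ((f : {poly K})`_i * (g : {poly K})`_j) *: linf_table i j.

Lemma linf_mulE (f g : Linf) :
  linf_mul f g = ((g : {poly K})`_0 *: ((f : {poly K}) * 'X) : {poly K}).
Proof.
rewrite /linf_mul; have [g0|g_gt0] := posnP (size (g : {poly K})).
  have -> : g = 0 by apply/eqP; rewrite -size_poly_eq0 g0.
  by rewrite coef0 scale0r big1 // => i _; rewrite size_poly0 big_ord0.
rewrite -[X in X * _](coefK (f : {poly K})) poly_def mulr_suml scaler_sumr.
apply: eq_bigr => i _; rewrite (bigD1 (Ordinal g_gt0)) //= big1 ?addr0.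
  by rewrite /linf_table /= /linf_e -scalerAl scalerA mulrC exprSr.
by move=> j /negPf; rewrite -val_eqE /= /linf_table => ->; rewrite scaler0.
Qed.

Lemma linf_mul_linearl (g : Linf) : linear (linf_mul^~ g).
Proof.
move=> a f h; rewrite !linf_mulE mulrDl scalerDr -scalerAl.
by rewrite scalerA mulrC -scalerA.
Qed.

Lemma linf_mul_linearr (f : Linf) : linear (linf_mul f).
Proof.
by move=> a g h; rewrite !linf_mulE coefD coefZ scalerDl -scalerA.
Qed.

HB.instance Definition _ :=
  Lmodule_isNAlgebra.Build K Linf linf_mul_linearl linf_mul_linearr.

Lemma linf_leibniz (x y z : Linf) :
  x ** (y ** z) = (x ** y) ** z - (x ** z) ** y.
Proof.
rewrite /amul /= !linf_mulE coefZ coefMX /= mulr0 scale0r.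
by rewrite -!scalerAl !scalerA [X in X *: _ - _]mulrC subrr.
Qed.

HB.instance Definition _ := NAlgebra_isLeibniz.Build K Linf linf_leibniz.

Lemma linf_eM i j : linf_e i ** linf_e j = if j == 0%N then linf_e i.+1 else 0.
Proof.
rewrite /amul /= linf_mulE /linf_e coefXn -exprSr eq_sym.
by case: eqP; rewrite ?scale1r ?scale0r.
Qed.

Lemma linf_e_span (f : Linf) :
  f = \sum_(i < size (f : {poly K})) (f : {poly K})`_i *: linf_e i.
Proof. by rewrite -[LHS](coefK (f : {poly K})) poly_def. Qed.

Lemma linf_e_free n (c : 'I_n -> K) :
  \sum_(i < n) c i *: linf_e i = 0 -> forall i, c i = 0.
Proof.
move=> c0 i; have /(congr1 (fun p : {poly K} => p`_i)) := c0.
rewrite coef0 coef_sum (bigD1 i) //= big1 ?addr0.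
  by rewrite coefZ coefXn eqxx mulr1.
move=> j ji; rewrite coefZ coefXn.
by move: ji; rewrite -val_eqE eq_sym => /negPf ->; rewrite mulr0.
Qed.

End Linf.

(* Main.v *)
Require Import Defs.
From HB Require Import structures.
From mathcomp Require Import all_boot all_algebra.
From mathcomp Require Import finmap classical_sets cardinality.
Local Open Scope classical_set_scope.
Local Open Scope ring_scope.

Set Implicit Arguments.
Unset Strict Implicit.
Unset Printing Implicit Defensive.

Import GRing.Theory.

(** Put J for the T-ideal generated by x_1(x_2x_3).  It lies in the ideal of
    identities since every product in L_oo has no e_1-component, and right
    multiplication by g only sees the e_1-component of g.

    Conversely, modulo J right multiplication by a product vanishes, so the
    Leibniz identity says that right multiplications commute.  Hence the free
    algebra is spanned modulo J by the left-normed words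
    x_i x_(j_1) ... x_(j_n), and such a word depends modulo J on i and on the
    multiset {j_1, ..., j_n} only ([span_words], [right_word_perm]).

    Let f be an identity, and write it modulo J as a finite combination of
    words.  Substituting x_i := t^(N^i) e_1 + b_i e_2 turns the word above into
    t^(N^(j_1) + ... + N^(j_n)) (t^(N^i) e_(n+1) + b_i e_(n+2)).  The part that is
    linear in b_i isolates the words with first letter x_i, and the exponent of t
    encodes the multiset {j_1, ..., j_n} in base N, faithfully if N exceeds its
    cardinality ([weight_inj]).  So for each i the words starting with x_i give a
    polynomial in t that vanishes on the infinite field K: it is zero, that is,
    the coefficients of the words equal modulo J add up to 0, and f is in J. *)

(** * Bilinearity and congruences modulo an ideal *)

HB.instance Definition _ (K : fieldType) (A : nalgType K) (x : A) :=
  GRing.isLinear.Build K A A *:%R (amul x) (amul_linearr x).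

Definition right_mul (K : fieldType) (A : nalgType K) (y x : A) : A := x ** y.

HB.instance Definition _ (K : fieldType) (A : nalgType K) (y : A) :=
  GRing.isLinear.Build K A A *:%R (right_mul y) (amul_linearl y).

Section IdealTheory.
Context {K : fieldType} {A : nalgType K} {I : set A} (idI : ideal I).
Implicit Types u v w : A.

Lemma ideal0 : I 0. Proof. by case: idI. Qed.

Lemma idealZ a u : I u -> I (a *: u).
Proof. by case: idI => I0 IL _ _ Iu; rewrite -[_ *: _]addr0; apply: IL. Qed.

Lemma idealD u v : I u -> I v -> I (u + v).
Proof. by case: idI => _ IL _ _ Iu Iv; rewrite -[u]scale1r; apply: IL. Qed.

Lemma idealN u : I u -> I (- u).
Proof. by rewrite -scaleN1r; apply: idealZ. Qed.

Lemma idealMr u v : I u -> I (u ** v). Proof. by case: idI => _ _ + _; apply. Qed.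

Lemma idealMl u v : I v -> I (u ** v). Proof. by case: idI => _ _ _; apply. Qed.

Lemma ideal_sum (T : Type) (l : seq T) (F : T -> A) (P : pred T) :
  (forall k, P k -> I (F k)) -> I (\sum_(k <- l | P k) F k).
Proof. by move=> IF; apply: big_ind => //; [apply: ideal0 | apply: idealD]. Qed.

Lemma idealB_trans v u w : I (u - v) -> I (v - w) -> I (u - w).
Proof. by move=> /idealD h /h; rewrite addrA subrK. Qed.

Lemma idealB_refl u : I (u - u).
Proof. by rewrite subrr; apply: ideal0. Qed.

Lemma idealBD u v u' v' : I (u - u') -> I (v - v') -> I (u + v - (u' + v')).
Proof. by move=> /idealD h /h; rewrite opprD addrACA. Qed.

Lemma idealBZ a u v : I (u - v) -> I (a *: u - a *: v).
Proof. by rewrite -scalerBr; apply: idealZ. Qed.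

Lemma idealBM u v u' v' : I (u - u') -> I (v - v') -> I (u ** v - u' ** v').
Proof.
move=> Iu Iv; apply: (@idealB_trans (u' ** v)).
  by have := idealMr v Iu; rewrite -![_ ** v]/(right_mul v _) linearB.
by rewrite -linearB; apply: idealMl.
Qed.

(** What the identity x(yz) = 0 of the quotient by I amounts to; the Leibniz
    identity then becomes (xy)z = (xz)y, the commutation of right
    multiplications. *)
Definition right_null := forall x y z : A, I (x ** (y ** z)).

End IdealTheory.

Arguments right_null {K A} I.

(** * Left-normed words *)

Definition right_word (K : fieldType) (u : freeLeibniz K nat) (s : seq nat) :=
  foldl (fun v j => v ** 'x_j) u s.

Section Words.
Context {K : fieldType} {I : set (freeLeibniz K nat)}.
Context (idI : ideal I) (nullI : right_null I).
Implicit Types (u v : freeLeibniz K nat) (s r : seq nat).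

Lemma right_mul_comm u v w : I (u ** v ** w - u ** w ** v).
Proof. by rewrite -leibniz; apply: nullI. Qed.

Lemma right_word_cong u v s : I (u - v) -> I (right_word u s - right_word v s).
Proof.
elim: s u v => //= j s IHs u v Iuv; apply: IHs.
by apply: (idealBM idI) => //; apply: (idealB_refl idI).
Qed.

(** Multiplying by x_j first or last gives the same word modulo I: pass x_j over
    the letters of [s] one at a time. *)
Lemma right_word_move u j s :
  I (right_word (u ** 'x_j) s - right_word u s ** 'x_j).
Proof.
elim: s u => [|k s IHs] u /=; first exact: (idealB_refl idI).
apply: (idealB_trans idI) (IHs _).
exact/right_word_cong/right_mul_comm.
Qed.

Lemma right_word_perm u s r :
  perm_eq s r -> I (right_word u s - right_word u r).
Proof.
elim: s r u => [|j s IHs] r u.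
  by rewrite perm_sym => /perm_nilP ->; apply: (idealB_refl idI).
move=> sr; have jr : j \in r by rewrite -(perm_mem sr) mem_head.
case/splitPr: jr sr => r1 r2 sr.
rewrite -[j :: r2]cat1s perm_sym perm_catCA /= perm_cons perm_sym in sr.
apply: (idealB_trans idI) (IHs _ _ sr) _.
by rewrite /right_word !foldl_cat; apply/right_word_cong/right_word_move.
Qed.

End Words.

(** Triples (coefficient, index of the first letter, indices of the other
    letters): the first letter is kept apart since it does not commute with the
    others modulo I. *)
Definition term (K : fieldType) : Type := (K * (nat * seq nat))%type.

Definition term_val (K : fieldType) (k : term K) : freeLeibniz K nat :=
  k.1 *: right_word 'x_(k.2.1) k.2.2.

Definition word_sum (K : fieldType) (l : seq (term K)) : freeLeibniz K nat :=
  \sum_(k <- l) term_val k.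

(** A word times a letter is a word, and a word times a longer word is in I, so
    the combinations of words form a subalgebra modulo I; it contains the
    generators. *)
Lemma span_words (K : fieldType) (I : set (freeLeibniz K nat)) :
  ideal I -> right_null I ->
  forall f, exists l, I (f - word_sum l).
Proof.
move=> idI nullI f.
pose Sp g := exists l, I (g - word_sum l).
have Sp0 : Sp 0 by exists [::]; rewrite /word_sum big_nil; apply: idealB_refl.
have SpD u v : Sp u -> Sp v -> Sp (u + v).
  move=> [l Iu] [m Iv]; exists (l ++ m).
  by rewrite /word_sum big_cat; apply: idealBD.
have SpZ a u : Sp u -> Sp (a *: u).
  move=> [l Iu]; exists [seq (a * k.1, k.2) | k <- l].
  rewrite /word_sum big_map /=.
  under eq_bigr do rewrite /term_val /= -scalerA.
  by rewrite -scaler_sumr; apply: idealBZ.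
have Sp_cong u v : I (u - v) -> Sp v -> Sp u.
  by move=> Iuv [l Iv]; exists l; apply: idealB_trans Iv.
have Sp_word i s : Sp (right_word 'x_i s).
  exists [:: (1, (i, s))].
  by rewrite /word_sum big_seq1 /term_val scale1r; apply: idealB_refl.
have SpM u v : Sp u -> Sp v -> Sp (u ** v).
  move=> [l Iu] [m Iv]; apply: (Sp_cong _ _ (idealBM idI Iu Iv)).
  rewrite /word_sum -[_ ** _]/(right_mul _ _) linear_sum.
  apply: big_ind => // -[a [i s]] _.
  rewrite /term_val linearZ; apply: (SpZ).
  rewrite /= /right_mul linear_sum; apply: big_ind => // -[b [j r]] _.
  rewrite /term_val linearZ; apply: (SpZ) => /=.
  case/lastP: r => [|r k] /=.
    by have := Sp_word i (rcons s j); rewrite /right_word foldl_rcons.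
  apply: (Sp_cong _ 0) => //.
  by rewrite subr0 /right_word foldl_rcons; apply: nullI.
rewrite -[f]freprK; elim: (frepr f) => [i||t IHt u IHu|t IHt|a t IHt|t IHt u IHu].
- exact: (Sp_word i [::]).
- exact: Sp0.
- by rewrite -faddE; apply: SpD.
- by rewrite -foppE; have := SpZ (-1) _ IHt; rewrite scaleN1r.
- by rewrite -fscaleE; apply: SpZ.
- by rewrite -fmulE; apply: SpM.
Qed.

(** * Encoding multisets in base N *)

Definition weight (N : nat) (s : seq nat) : nat := (\sum_(j <- s) N ^ j)%N.

(** There are fewer than N letters, so those below j contribute less than N^j;
    those above j contribute a multiple of N^(j+1). Hence the multiplicity of j
    is the digit of rank j in base N. *)
Lemma count_weight N s j :
  (size s < N)%N -> count_mem j s = ((weight N s %/ N ^ j) %% N)%N.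
Proof.
move=> sN; have N0 : (0 < N)%N by apply: leq_ltn_trans sN.
have Nj0 : (0 < N ^ j)%N by rewrite expn_gt0 N0.
pose low := (\sum_(i <- s | (i < j)%N) N ^ i)%N.
pose high := (\sum_(i <- s | (j < i)%N) N ^ (i - j.+1))%N.
have wE : weight N s = ((high * N + count_mem j s) * N ^ j + low)%N.
  rewrite /weight (bigID (fun i => i < j)%N) /= addnC; congr (_ + _)%N.
  rewrite (bigID (fun i => j < i)%N) /= mulnDl; congr (_ + _)%N.
    rewrite -mulnA -expnS big_distrl /=.
    apply: eq_big => [i|i /andP[_ ji]].
      by rewrite -leqNgt; case: ltngtP.
    by rewrite -expnD subnK.
  rewrite -sum1_count big_distrl /=; apply: eq_big => i; rewrite -!leqNgt -eqn_leq.
    exact: eq_sym.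
  by move=> /eqP ->; rewrite mul1n.
have lowN : (low < N ^ j)%N.
  rewrite -(ltn_pmul2l N0); apply: (@leq_ltn_trans (size s * N ^ j)%N).
    rewrite /low big_distrr /= -sum1_size big_distrl /= big_mkcond /=.
    apply: leq_sum => i _; case: ifP => // ij.
    by rewrite -expnS mul1n leq_pexp2l.
  by rewrite ltn_pmul2r.
rewrite wE divnMDl // divn_small // addn0 modnMDl modn_small //.
exact: leq_ltn_trans (count_size _ _) sN.
Qed.

Lemma weight_inj N s r : (size s < N)%N -> (size r < N)%N ->
  weight N s = weight N r -> perm_eq s r.
Proof.
move=> sN rN sr; apply/allP => j _ /=.
by rewrite (count_weight j sN) (count_weight j rN) sr.
Qed.

(** * Evaluation of words in L_oo *)

Lemma nalg_homB (K : fieldType) (A B : nalgType K) (h : A -> B) u v :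
  nalg_hom h -> h (u - v) = h u - h v.
Proof.
by move=> [hlin _]; rewrite addrC -scaleN1r hlin scaleN1r addrC.
Qed.

Lemma nalg_hom0 (K : fieldType) (A B : nalgType K) (h : A -> B) :
  nalg_hom h -> h 0 = 0.
Proof. by move=> hh; rewrite -[0 in LHS](subrr 0) nalg_homB // subrr. Qed.

Lemma nalg_hom_comp (K : fieldType) (A B C : nalgType K)
    (g : B -> C) (h : A -> B) :
  nalg_hom g -> nalg_hom h -> nalg_hom (g \o h).
Proof.
move=> [glin gM] [hlin hM]; split=> [a u v|u v] /=; first by rewrite hlin glin.
by rewrite hM gM.
Qed.

Lemma Id_T_ideal (K : fieldType) (L : leibnizAlgType K) : T_ideal (Id L).
Proof.
split=> [|g hg u Iu h hh]; last exact: (Iu _ (nalg_hom_comp hh hg)).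
split=> [h|a u v Iu Iv h hh|u v Iu h hh|u v Iv h hh].
- exact: nalg_hom0.
- by have [hlin _] := hh; rewrite hlin Iu // Iv // scaler0 addr0.
- have [_ hM] := hh; rewrite hM Iu //.
  by rewrite -[_ ** _]/(right_mul _ _) linear0.
- by have [_ hM] := hh; rewrite hM Iv // linear0.
Qed.

Lemma Linf_right_null (K : fieldType) (x y z : Linf K) : x ** (y ** z) = 0.
Proof. by rewrite /amul /= !linf_mulE coefZ coefMX mulr0 scale0r. Qed.

(** The substitution x_i := t^(N^i) e_1 + b_i e_2. The e_1-component decides how
    x_i acts on the right, and the e_2-component is seen only when x_i is the
    first letter, so b can be used to tell the first letters apart. *)
Definition test_hom (K : fieldType) (N : nat) (t : K) (b : nat -> K) :=
  flift (fun i => ((t ^+ (N ^ i))%:P + b i *: 'X : {poly K}) : Linf K).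

HB.instance Definition _ (K : fieldType) N (t : K) b :=
  GRing.isLinear.Build K (freeLeibniz K nat) (Linf K) *:%R (test_hom N t b)
    (proj1 (flift_hom _)).

Lemma test_hom_word (K : fieldType) N (t : K) b u s :
  test_hom N t b (right_word u s) =
  (t ^+ weight N s *: ((test_hom N t b u : {poly K}) * 'X^(size s)) : {poly K}).
Proof.
elim: s u => [|j s IHs] u /=.
  by rewrite /weight big_nil scale1r mulr1.
have [_ hM] : nalg_hom (test_hom N t b) := flift_hom _.
rewrite IHs hM {2}/test_hom flift_gen /amul /= linf_mulE.
rewrite coefD coefC coefZ coefX mulr0 addr0 /=.
rewrite -scalerAl scalerA -mulrA -exprS; congr (_ *: _).
by rewrite /weight big_cons exprD mulrC.
Qed.

(** Its coefficients are the sums of the coefficients of the words of [l] that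
    have the same first letter x_i and the same weight. *)
Definition letter_poly (K : fieldType) N (l : seq (term K)) (i : nat) :
  {poly K} := \sum_(k <- l | k.2.1 == i) k.1 *: 'X^(weight N k.2.2).

(** Changing b_i from 0 to 1 changes the value of the words with first letter
    x_i only, by t^weight e_(n+2); adding up the coordinates, which is evaluation
    of the polynomials at 1, then forgets the length n+1 of the word. *)
Lemma letter_poly_root (K : fieldType) N (l : seq (term K)) i (t : K) :
  (forall b, test_hom N t b (word_sum l) = 0) -> (letter_poly N l i).[t] = 0.
Proof.
move=> l0.
have val b : (\sum_(k <- l) (k.1 * t ^+ weight N k.2.2 *
    (t ^+ (N ^ k.2.1) + b k.2.1))) = 0.
  have /(congr1 (fun p : {poly K} => p.[1])) := l0 b.
  rewrite horner0 => l1; rewrite -[RHS]l1 linear_sum horner_sum.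
  apply: eq_bigr => k _.
  rewrite linearZ hornerZ /= test_hom_word /test_hom flift_gen.
  by rewrite !hornerE expr1n [RHS]mulr1.
have := congr1 (fun x => x - 0) (val (fun j => (j == i)%:R)).
rewrite -[X in _ - X = _](val (fun=> 0)) subr0 -sumrB => l1.
rewrite -[RHS]l1 /letter_poly horner_sum big_mkcond /=; apply: eq_bigr => k _.
rewrite addr0 -mulrBr addrAC subrr add0r.
by case: eqP => _; rewrite ?mulr0 // mulr1 !hornerE.
Qed.

Lemma poly_eq0_infinite (K : fieldType) (p : {poly K}) :
  infinite_set [set: K] -> (forall t, p.[t] = 0) -> p = 0.
Proof.
move=> infK p0; apply/eqP; apply: contraT => pN0.
have [B _ sB] := infinite_set_fset (size p) infK.
have : all (root p) (enum_fset B) by apply/allP => t _; apply/rootP.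
by move=> /(max_poly_roots pN0) /(_ (fset_uniq B)); rewrite ltnNge sB.
Qed.

(** Words with the same first letter and the same weight are congruent modulo I,
    and the vanishing of the letter polynomials says that in each such class the
    coefficients add up to 0. *)
Lemma word_sum_ideal (K : fieldType) (I : set (freeLeibniz K nat)) N
    (l : seq (term K)) :
  ideal I -> right_null I -> {in l, forall k, size k.2.2 < N}%N ->
  (forall i, letter_poly N l i = 0) -> I (word_sum l).
Proof.
move=> idI nullI lN l0.
(* Choosing one word W q in each class turns the congruence into an equality. *)
pose decode e := xget [::] [set s | (size s < N)%N /\ weight N s = e].
have decodeP s : (size s < N)%N -> perm_eq s (decode (weight N s)).
  move=> sN; have [dN dE] : (size (decode (weight N s)) < N)%N /\
      weight N (decode (weight N s)) = weight N s.
    exact: (@xgetPex _ [::] [set r | (size r < N)%N /\ weight N r = weight N s]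
      (ex_intro _ s (conj sN erefl))).
  exact: weight_inj sN dN (esym dE).
pose key (k : term K) := (k.2.1, weight N k.2.2).
pose W (q : nat * nat) := right_word ('x_(q.1) : freeLeibniz K nat) (decode q.2).
pose keys := undup [seq key k | k <- l].
have sumW0 : \sum_(k <- l) k.1 *: W (key k) = 0.
  transitivity (\sum_(k <- l) \sum_(q <- keys | q == key k) k.1 *: W q).
    rewrite [LHS]big_seq [RHS]big_seq; apply: eq_bigr => k kl.
    rewrite big_mkcond (bigD1_seq (key k)) ?undup_uniq ?mem_undup ?map_f //=.
    by rewrite eqxx big1 ?addr0 // => q /negPf ->.
  rewrite (exchange_big_dep predT) //=; apply: big1 => q _.
  rewrite -scaler_suml.
  have /(congr1 (fun p : {poly K} => p`_q.2)) := l0 q.1.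
  rewrite coef0 coef_sum => cq.
  suff -> : \sum_(k <- l | q == key k) k.1 = 0 by rewrite scale0r.
  rewrite -[RHS]cq [RHS]big_mkcond [LHS]big_mkcond; apply: eq_bigr => k _.
  rewrite coefZ coefXn; case: q {cq} => i e /=.
  rewrite xpair_eqE /= [i == _]eq_sym.
  by case: eqP => //= _; case: eqP => _; rewrite ?mulr1 ?mulr0.
rewrite -[word_sum l]subr0 -sumW0 -sumrB big_seq; apply: (ideal_sum idI) => k kl.
exact/(idealBZ idI)/(right_word_perm idI nullI)/decodeP/lN.
Qed.

Theorem theorem18 (K : fieldType) (infK : infinite_set [set: K]) :
  Id_basis (Linf K) [set 'x_0 ** ('x_1 ** 'x_2)].
Proof.
have sub : [set 'x_0 ** ('x_1 ** 'x_2)] `<=` Id (Linf K).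
  by move=> _ -> h [_ hM]; rewrite !hM Linf_right_null.
split=> //.
set J := smallest _ _; have JT : T_ideal J := smallest_T_ideal _.
have JId : J `<=` Id (Linf K).
  by move=> f; apply; split=> //; apply: Id_T_ideal.
have [idJ endJ] := JT.
have nullJ : right_null J.
  (* x(yz) is the image of the generator of J under an endomorphism. *)
  move=> x y z; pose g := flift (fun i => nth z [:: x; y] i).
  have gh : nalg_hom g := flift_hom _.
  have /(endJ _ gh) : J ('x_0 ** ('x_1 ** 'x_2)) by move=> I [_]; apply.
  by have [_ gM] := gh; rewrite !gM /g !flift_gen.
apply/seteqP; split=> // f fId.
have [l fl] := span_words idJ nullJ f.
suff lJ : J (word_sum l) by rewrite -[f](subrK (word_sum l)); apply: (idealD idJ).
have [idI _] := Id_T_ideal (Linf K).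
have lId : Id (Linf K) (word_sum l).
  rewrite -[word_sum l](subKr f).
  by apply: (idealD idI) => //; apply: (idealN idI); exact: JId fl.
(* Words of l have fewer than N letters after the first. *)
pose N := (\max_(k <- l) size k.2.2).+1.
apply: (@word_sum_ideal _ _ N) => // [k kl|i].
  by rewrite ltnS; apply: leq_bigmax_seq.
apply: poly_eq0_infinite => // t; apply: letter_poly_root => b.
exact/lId/flift_hom.
Qed.
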